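(* For every positive integer $k$, every $[\lceil k/2\rceil,k,k]$-partite graph has an independent covering with respect to its $[\lceil k/2\rceil,k,k]$-partition. That is, $c(k,k)\geq \lceil k/2\rceil$.
   Context: A graph is $[n,k,r]$-partite if its vertex set can be partitioned into $n$ independent sets (vertex classes) of size $k$ such that between every pair of these independent sets the edges form exactly $r$ pairwise disjoint edges, and there are no other edges; such a partition is an $[n,k,r]$-partition. Given a partition $P$ of the vertex set, an independent transversal with respect to $P$ is an independent set containing exactly one vertex from each class of $P$; an independent covering with respect to $P$ is a collection of pairwise disjoint independent transversals with respect to $P$ whose union is the whole vertex set. $c(k,r)$ denotes the maximal $n$ such that every $[n,k,r]$-partite graph has an independent covering with respect to its given $[n,k,r]$-partition. *)

(* Defs.v *)
From mathcomp Require Import all_boot.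

Set Implicit Arguments.
Unset Strict Implicit.
Unset Printing Implicit Defensive.

Section Graph.
(* A finite simple graph is a symmetric irreflexive relation [e]; these two
   conditions are imposed where graphs are quantified over. *)
Variables (V : finType) (e : rel V).

Definition independent (S : {set V}) : bool :=
  [forall x in S, forall y in S, ~~ e x y].

Definition edges_between (A B : {set V}) : {set {set V}} :=
  [set [set x; y] | x in A, y in B & e x y].

(* "No other edges" is the independence of the classes: an edge that does not
   run between two distinct classes lies inside one of them. *)
Definition nkr_partition (n k r : nat) (P : {set {set V}}) : Prop :=
  [/\ partition P [set: V],
      #|P| = n,
      (forall A, A \in P -> #|A| = k /\ independent A) &
      (forall A B, A \in P -> B \in P -> A != B ->
         #|edges_between A B| = r /\ trivIset (edges_between A B))].

Definition independent_transversal (P : {set {set V}}) (T : {set V}) : bool :=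
  is_transversal T P [set: V] && independent T.

Definition independent_covering (P C : {set {set V}}) : Prop :=
  [/\ (forall T, T \in C -> independent_transversal P T),
      trivIset C &
      cover C = [set: V]].

End Graph.

Definition always_covered (n k r : nat) : Prop :=
  forall (V : finType) (e : rel V), symmetric e -> irreflexive e ->
  forall P : {set {set V}}, nkr_partition e n k r P ->
  exists C : {set {set V}}, independent_covering e P C.

(* [c] is the maximal [n] such that every [n,k,r]-partite graph has an
   independent covering.  This is a relation rather than a function because
   the maximum need not exist for all [k] and [r] (e.g. for [r = 0]). *)
Definition is_covering_number (k r c : nat) : Prop :=
  always_covered c k r /\ forall n, always_covered n k r -> n <= c.

(* Main.v *)
Require Import Defs.
From mathcomp Require Import all_boot.
From mathcomp Require Import perm zify.
From Stdlib Require Import Classical_Prop.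

Set Implicit Arguments.
Unset Strict Implicit.
Unset Printing Implicit Defensive.

(** An independent covering is a [k]-colouring of the vertices, injective on
each class, with no monochromatic edge.  Among the colourings injective on each
class take one with the fewest monochromatic edges, and suppose that [x], in
the class [A], lies on such an edge.  For each other class, at most two vertices
[z] of [A] are such that exchanging the colours of [x] and [z] makes an edge at
[x] or [z] into that class monochromatic: the one adjacent to the vertex that
has the colour of [x], and the one having the colour of the neighbour of [x].
As [2 (n - 1) < k], some [z] in [A] avoids all of them, and the exchange strictly
decreases the number of monochromatic edges.

For the maximum to exist, [n] has to be bounded: in the disjoint union of [k]
cliques on [n] vertices, an independent transversal meets [n] distinct cliques,
so [n <= k]. *)

(** * Classes of a partition and neighbours across them *)

Section Partite.
Variables (V : finType) (e : rel V) (n k r : nat) (P : {set {set V}}).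
Hypotheses (e_sym : symmetric e) (e_irr : irreflexive e).
Hypothesis partP : nkr_partition e n k r P.

Lemma nkr_pblock x : pblock P x \in P.
Proof.
case: partP => /and3P[/eqP covP _ _] _ _ _.
by apply: pblock_mem; rewrite covP inE.
Qed.

Lemma nkr_mem_pblock x : x \in pblock P x.
Proof.
by case: partP => /and3P[/eqP covP _ _] _ _ _; rewrite mem_pblock covP inE.
Qed.

Lemma nkr_def_pblock B x : B \in P -> x \in B -> pblock P x = B.
Proof. by case: partP => /and3P[_ trivP _] _ _ _; apply: def_pblock. Qed.

Lemma nkr_edge_pblock x y : e x y -> pblock P x != pblock P y.
Proof.
move=> exy; apply/eqP => eqA; case: partP => _ _ /(_ _ (nkr_pblock x))[_].
move/forall_inP=> /(_ x (nkr_mem_pblock x))/forall_inP indA _.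
by have := indA y; rewrite eqA nkr_mem_pblock exy => /(_ isT).
Qed.

(** Two different edges from [x] into [B] would share [x], while the edges between two classes are
    pairwise disjoint. *)
Lemma nkr_neighbor_uniq B x y y' :
  B \in P -> y \in B -> y' \in B -> e x y -> e x y' -> y = y'.
Proof.
move=> PB By By' exy exy'; apply/eqP; apply: contraT => neq_yy'.
have neqAB : pblock P x != B.
  by rewrite -(nkr_def_pblock PB By); apply: nkr_edge_pblock.
case: partP => _ _ _ /(_ _ _ (nkr_pblock x) PB neqAB)[_ /trivIsetP trivE].
have edgeE w : w \in B -> e x w ->
    [set x; w] \in edges_between e (pblock P x) B.
  by move=> Bw exw; apply: imset2_f; rewrite ?inE ?nkr_mem_pblock ?Bw.
have neqE : [set x; y] != [set x; y'].
  apply: contra neq_yy' => /eqP/setP/(_ y); rewrite !inE eqxx orbT.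
  case/esym/orP=> // /eqP yx; by rewrite yx e_irr in exy.
have /pred0P/(_ x)/= := trivE _ _ (edgeE y By exy) (edgeE y' By' exy') neqE.
by rewrite !inE eqxx.
Qed.

(** * Colourings injective on classes, and the exchange of two colours *)

Definition class_injective (f : {ffun V -> 'I_k}) : bool :=
  [forall B in P, dinjectiveb f B].

(** Ordered pairs: each monochromatic edge counts twice, which does not affect minimality. *)
Definition conflicts (f : {ffun V -> 'I_k}) : {set V * V} :=
  [set u | e u.1 u.2 && (f u.1 == f u.2)].

Lemma class_injectiveP (f : {ffun V -> 'I_k}) :
  reflect (forall B, B \in P -> {in B &, injective f}) (class_injective f).
Proof.
by apply: (iffP forall_inP) => injf B PB; apply/dinjectiveP; apply: injf.
Qed.

Lemma class_injective_exists : 0 < k -> exists f, class_injective f.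
Proof.
move=> k_gt0; pose a0 : 'I_k := Ordinal k_gt0.
(* The colour of [x] is its position in its own class; [a0] is only the default of [insubd]. *)
pose f x := insubd a0 (index x (enum (pblock P x))).
exists [ffun x => f x]; apply/class_injectiveP => B PB x y Bx By.
have cardB : #|B| = k by case: partP => _ _ /(_ B PB)[].
have ltB z : z \in B -> index z (enum B) < k.
  by move=> Bz; rewrite -cardB cardE index_mem mem_enum.
rewrite !ffunE /f (nkr_def_pblock PB Bx) (nkr_def_pblock PB By).
move/(congr1 val); rewrite /= !insubdK; try exact: ltB.
by move/index_inj; apply; rewrite ?mem_enum.
Qed.

(** Each of the other [n.-1] classes excludes at most two of the [k] candidates [z]. The case
    [z = x] is allowed here; the second condition rules it out as soon as [x] lies on a
    monochromatic edge. *)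
Lemma exchange_exists f x : class_injective f -> n.-1.*2 < k ->
  exists2 z, z \in pblock P x &
    forall w, (e z w -> f w != f x) /\ (e x w -> f w != f z).
Proof.
move=> /class_injectiveP injf lt_nk; set A := pblock P x.
have PA : A \in P := nkr_pblock x.
pose bad1 (B : {set V}) := [set z in A | [exists w in B, e z w && (f w == f x)]].
pose bad2 (B : {set V}) := [set z in A | [exists w in B, e x w && (f w == f z)]].
(* At most one vertex of [B] has the colour [f x], and it has at most one neighbour in [A]. *)
have bad1_le B : B \in P -> #|bad1 B| <= 1.
  move=> PB; apply/card_le1_eqP => z' z; rewrite !inE.
  case/andP=> Az' /exists_inP[w' Bw' /andP[ezw' /eqP fw']].
  case/andP=> Az /exists_inP[w Bw /andP[ezw /eqP fw]].
  have eqw : w = w' by apply: (injf B PB) => //; rewrite fw.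
  rewrite -{w' Bw' fw'}eqw in ezw'.
  by apply: (nkr_neighbor_uniq (x := w) PA); rewrite // e_sym.
(* [x] has at most one neighbour in [B], and at most one vertex of [A] has the colour of that
   neighbour. *)
have bad2_le B : B \in P -> #|bad2 B| <= 1.
  move=> PB; apply/card_le1_eqP => z' z; rewrite !inE.
  case/andP=> Az' /exists_inP[w' Bw' /andP[exw' /eqP fw']].
  case/andP=> Az /exists_inP[w Bw /andP[exw /eqP fw]].
  have eqw : w = w' by apply: (nkr_neighbor_uniq (x := x) PB).
  by apply: (injf A PA) => //; rewrite -fw -fw' eqw.
pose bad := \bigcup_(B in P :\ A) (bad1 B :|: bad2 B).
have card_bad : #|bad| <= n.-1.*2.
  apply: (@leq_trans (\sum_(B in P :\ A) 2)).
    apply: (big_ind2 (fun (S : {set V}) m => #|S| <= m)) => [|S1 m1 S2 m2|B].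
    - by rewrite cards0.
    - by move=> le1 le2; apply: leq_trans (leq_card_setU _ _) (leq_add le1 le2).
    case/setD1P=> _ PB; apply: leq_trans (leq_card_setU _ _) _.
    exact: (leq_add (bad1_le _ PB) (bad2_le _ PB)).
  rewrite sum_nat_const muln2 leq_double.
  by case: partP => _ <- _ _; rewrite (cardsD1 A P) PA.
have cardA : #|A| = k by case: partP => _ _ /(_ A PA)[].
have /subsetPn[z Az zP] : ~~ (A \subset bad).
  by apply/negP => /subset_leq_card; rewrite cardA; lia.
exists z => // w.
have eqA : pblock P z = A := nkr_def_pblock PA Az.
have good : pblock P w != A -> w \in pblock P w ->
    ~~ ((e z w && (f w == f x)) || (e x w && (f w == f z))).
  move=> neqA Bw; apply: contra zP => zbad; apply/bigcupP.
  exists (pblock P w); first by rewrite !inE neqA nkr_pblock.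
  by rewrite !inE Az; case/orP: zbad => [H|H]; apply/orP; [left|right];
    apply/exists_inP; exists w.
split=> [ezw|exw].
  have := nkr_edge_pblock ezw; rewrite eqA eq_sym => /good.
  by rewrite nkr_mem_pblock ezw => /(_ isT) /norP[].
have := nkr_edge_pblock exw; rewrite eq_sym => /good.
by rewrite nkr_mem_pblock exw => /(_ isT) /norP[].
Qed.

Lemma conflicts_exchange f x y : class_injective f -> n.-1.*2 < k ->
  e x y -> f x = f y ->
  exists2 g, class_injective g & #|conflicts g| < #|conflicts f|.
Proof.
move=> injf lt_nk exy fxy.
have [z Az zP] := exchange_exists x injf lt_nk.
move/class_injectiveP: injf => injf.
have eqA : pblock P z = pblock P x := nkr_def_pblock (nkr_pblock x) Az.
have tpermP t : pblock P (tperm x z t) = pblock P t by case: tpermP => // ->.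
pose g := [ffun t => f (tperm x z t)].
(* Only [x] and [z] may change colour, and a neighbour of a vertex of their class lies outside that
   class. *)
have away t w : pblock P t = pblock P x -> e t w -> g w = f w.
  move=> eqt /nkr_edge_pblock; rewrite eqt => neqA.
  by rewrite ffunE tpermD //; apply: contraNneq neqA => <-; rewrite ?eqA.
have gx : g x = f z by rewrite ffunE tpermL.
have gz : g z = f x by rewrite ffunE tpermR.
have g_good t w : t \in [set x; z] -> e t w -> g t != g w.
  case/set2P=> -> etw; rewrite (away _ _ _ etw) // ?gx ?gz eq_sym.
    by case: (zP w) => _; apply.
  by case: (zP w) => + _; apply.
exists g.
  apply/class_injectiveP => B PB t t' Bt Bt'; rewrite !ffunE => eqf.
  (* The transposition permutes each class, so [g] inherits injectivity from [f]. *)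
  have memB s : s \in B -> tperm x z s \in B.
    by move=> Bs; rewrite -(nkr_def_pblock PB Bs) -tpermP nkr_mem_pblock.
  by apply: (@perm_inj _ (tperm x z)); apply: (injf B PB); rewrite ?memB.
(* No edge at [x] or [z] is monochromatic under [g], and all other edges keep their colours; so no
   conflict arises, and [(x, y)] disappears. *)
apply/proper_card/properP; split.
  apply/subsetP => -[t w]; rewrite !inE /= => /andP[etw gtw].
  have tN : t \notin [set x; z].
    by apply: contraL gtw => tP; apply: g_good.
  have wN : w \notin [set x; z].
    apply: contraL gtw => wP; rewrite eq_sym; apply: g_good => //.
    by rewrite e_sym.
  move: tN wN gtw; rewrite !inE !negb_or etw => /andP[tx tz] /andP[wx wz].
  by rewrite !ffunE !tpermD // eq_sym.
exists (x, y); first by rewrite inE /= exy fxy eqxx.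
by rewrite inE /= exy g_good // set21.
Qed.

Lemma conflict_free_exists : n.-1.*2 < k ->
  exists2 f, class_injective f & forall x y, e x y -> f x != f y.
Proof.
move=> lt_nk; have [f0 injf0] := class_injective_exists (leq_ltn_trans (leq0n _) lt_nk).
case: (@arg_minnP _ f0 class_injective (fun f => #|conflicts f|) injf0).
move=> f injf minf; exists f => // x y exy; apply/eqP => fxy.
have [g injg] := conflicts_exchange injf lt_nk exy fxy.
by rewrite ltnNge minf.
Qed.

(** The colour classes form the covering: they are independent for want of monochromatic edges, and
    each meets every class of [P] exactly once. *)
Lemma conflict_free_covering f : class_injective f ->
  (forall x y, e x y -> f x != f y) ->
  independent_covering e P (preim_partition f [set: V]).
Proof.
move=> /class_injectiveP injf freef.
have /and3P[/eqP covC trivC _] := preim_partitionP f [set: V].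
split=> // T /imsetP[x _ ->]; apply/andP; split; last first.
  apply/forall_inP => y; rewrite !inE => /eqP fy.
  apply/forall_inP => z; rewrite !inE => /eqP fz.
  by apply/negP => /freef; rewrite -fy fz eqxx.
case: partP => partitP _ cardP _; apply/and3P; split=> //.
apply/forall_inP => B PB; apply/cards1P.
(* [f] is injective on the [k] vertices of [B], so all [k] colours occur there. *)
have /imsetP[y By fxy] : f x \in f @: B.
  suff -> : f @: B = setT by rewrite inE.
  apply/eqP; rewrite eqEcard subsetT cardsT card_ord card_in_imset.
    by case: (cardP B PB) => -> _ /=.
  exact: (injf B PB).
exists y; apply/setP => z; rewrite !inE /=; apply/idP/eqP => [/andP[/eqP fz Bz]|->].
  by apply: (injf B PB); rewrite // -fz.
by rewrite fxy eqxx.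
Qed.

End Partite.

Lemma always_covered_small n k r : n.-1.*2 < k -> always_covered n k r.
Proof.
move=> lt_nk V e e_sym e_irr P partP.
have [f injf freef] := conflict_free_exists e_sym e_irr partP lt_nk.
by exists (preim_partition f [set: V]); apply: conflict_free_covering partP _ _ _.
Qed.

(** * The upper bound from disjoint cliques *)

Section DisjointCliques.
Variables n k : nat.

(** The first coordinate of a vertex is its class, the second its clique. *)
Definition clique_rel : rel ('I_n * 'I_k) :=
  fun u v => (u.1 != v.1) && (u.2 == v.2).

Definition clique_class (i : 'I_n) : {set 'I_n * 'I_k} := [set u | u.1 == i].

Definition clique_classes : {set {set 'I_n * 'I_k}} :=
  [set clique_class i | i : 'I_n].

Lemma card_clique_class i : #|clique_class i| = k.
Proof.
have -> : clique_class i = [set (i, a) | a : 'I_k].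
  apply/setP => -[j a]; rewrite inE /=; apply/eqP/imsetP => [->|[b _ []] //].
  by exists a.
by rewrite card_imset ?card_ord // => a b [].
Qed.

Lemma edges_between_clique_class i j : i != j ->
  edges_between clique_rel (clique_class i) (clique_class j) =
  [set [set (i, a); (j, a)] | a : 'I_k].
Proof.
move=> neq_ij; apply/setP => E; apply/imset2P/imsetP.
  case=> -[i' a] [j' b]; rewrite !inE /= => /eqP-> /andP[/eqP-> /andP[_ /eqP/= ->]] ->.
  by exists b.
by case=> a _ ->; exists (i, a) (j, a); rewrite ?inE /clique_rel /= ?eqxx ?neq_ij.
Qed.

Lemma clique_nkr_partition : 0 < k ->
  nkr_partition clique_rel n k k clique_classes.
Proof.
(* The vertex [(i, a0)] shows that the classes are nonempty and pairwise distinct. *)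
move=> k_gt0; pose a0 := Ordinal k_gt0.
have inj_class : injective clique_class.
  by move=> i j /setP/(_ (i, a0)); rewrite !inE eqxx => /esym/eqP.
split.
- apply/and3P; split.
  + apply/eqP/setP => u; rewrite inE; apply/bigcupP.
    by exists (clique_class u.1); rewrite ?imset_f ?inE.
  + apply/trivIsetP => _ _ /imsetP[i _ ->] /imsetP[j _ ->] neq.
    apply/pred0P => u /=; rewrite !inE; apply/negP => /andP[/eqP ui /eqP uj].
    by rewrite -ui -uj eqxx in neq.
  + apply/imsetP => -[i _ /setP/(_ (i, a0))]; by rewrite !inE eqxx.
- by rewrite card_imset ?card_ord.
- move=> _ /imsetP[i _ ->]; split; first exact: card_clique_class.
  apply/forall_inP => u; rewrite inE => /eqP ui.
  apply/forall_inP => v; rewrite inE => /eqP vi.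
  by rewrite /clique_rel ui vi eqxx.
move=> _ _ /imsetP[i _ ->] /imsetP[j _ ->] neq.
have neq_ij : i != j by apply: contraNneq neq => ->.
rewrite edges_between_clique_class //; split.
  rewrite card_imset ?card_ord // => a b /setP/(_ (i, a)).
  rewrite !inE eqxx !xpair_eqE eqxx (negPf neq_ij) /= orbF.
  by rewrite eqxx => /esym/eqP.
apply/trivIsetP => _ _ /imsetP[a _ ->] /imsetP[b _ ->] neqE.
apply/pred0P => -[l c] /=; rewrite !inE !xpair_eqE; apply/negP => /andP[uA uB].
have ca : c = a by case/orP: uA => /andP[_ /eqP].
have cb : c = b by case/orP: uB => /andP[_ /eqP].
by rewrite -ca cb eqxx in neqE.
Qed.

Lemma clique_transversal_leq T :
  independent_transversal clique_rel clique_classes T -> n <= k.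
Proof.
case/andP=> /and3P[_ _ /forall_inP cardT] indT.
have exT i : exists a, (i, a) \in T.
  have /cards1P[u /setP/(_ u)] := cardT (clique_class i) (imset_f _ isT).
  rewrite !inE eqxx => /andP[Tu /eqP ui].
  by exists u.2; rewrite -ui -surjective_pairing.
(* [h i] is the clique of a vertex of [T] in class [i]; a repeated clique would give an edge inside
   [T]. *)
pose h i := xchoose (exT i).
have injh : injective h.
  move=> i j hij; apply/eqP; apply: contraT => neq_ij.
  have /forall_inP/(_ _ (xchooseP (exT i)))/forall_inP/(_ _ (xchooseP (exT j))) := indT.
  by rewrite /clique_rel /= neq_ij -/(h i) -/(h j) hij eqxx.
by have := leq_card h injh; rewrite !card_ord.
Qed.

End DisjointCliques.

Lemma always_covered_leq n k : 0 < k -> always_covered n k k -> n <= k.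
Proof.
(* For a positive number of classes the graph has a vertex, so its covering contains at least one
   transversal. *)
move=> k_gt0; case: n => // n covnk.
have sym : symmetric (@clique_rel n.+1 k).
  by move=> u v; rewrite /clique_rel eq_sym [u.2 == _]eq_sym.
have irr : irreflexive (@clique_rel n.+1 k).
  by move=> u; rewrite /clique_rel eqxx.
have [C [transC _ covC]] := covnk _ _ sym irr _ (clique_nkr_partition n.+1 k_gt0).
have : (ord0, Ordinal k_gt0) \in cover C by rewrite covC inE.
by case/bigcupP=> T /transC /clique_transversal_leq.
Qed.

(** * Existence of the maximum *)

Lemma nat_bounded_max (Q : nat -> Prop) b m :
  (forall i, Q i -> i <= b) -> Q m ->
  exists c, [/\ Q c, forall i, Q i -> i <= c & m <= c].
Proof.
(* Induction on a bound for [b - m]: a larger element of [Q] brings [m] closer to [b]. As [Q] is an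
   arbitrary predicate, whether one exists is decided classically. *)
move=> Qb; elim: {m}(b - m) {-2}m (leqnn (b - m)) => [|d IHd] m ltd Qm.
  by exists m; split=> // i /Qb; lia.
case: (classic (exists2 i, Q i & m < i)) => [[i Qi lt_mi]|maxm].
  have [|c [Qc maxc le_ic]] := IHd i _ Qi; first by have := Qb _ Qi; lia.
  by exists c; split=> //; lia.
exists m; split=> // i Qi; rewrite leqNgt; apply/negP => lt_mi.
by apply: maxm; exists i.
Qed.

(* [uphalf k] is the ceiling of k/2. *)
Theorem theorem3 (k : nat) (k_gt0 : 0 < k) :
  always_covered (uphalf k) k k /\
  exists2 c : nat, is_covering_number k k c & uphalf k <= c.
Proof.
(* Twice [(uphalf k).-1] is [k - 2] for even [k] and [k - 1] for odd [k]. *)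
have cov : always_covered (uphalf k) k k by apply: always_covered_small; lia.
split=> //.
have [c [covc maxc le_c]] :=
  nat_bounded_max (fun i => @always_covered_leq i k k_gt0) cov.
by exists c.
Qed.
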